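(* Let $n>2$ be an integer, let $K$ be an arbitrary group of order $n$ with identity element $e_K$, let $w$ be an arbitrary non-identity element of $K$, and let $H=S_2\wr K$ be the wreath product, whose elements are the triples $(g;k_1,k_2)$ with $g\in S_2$, $k_1,k_2\in K$, with multiplication $(g;k_1,k_2)(g';k'_1,k'_2)=(gg';\,k_1k'_{1^g},\,k_2k'_{2^g})$. Let $e$ denote the identity of $S_2$ and $\pi=(1,2)$ the transposition in $S_2$, and put $$A=\{(e;u,u): u\in K,\ u\neq e_K\},\quad B=\{(e;e_K,u): u\in K,\ u\neq e_K\},$$ $$C=\{(\pi;u,e_K): u\in K\},\quad D=\{(\pi;u,w): u\in K\}.$$ Let $Y=A\cup B\cup C\cup D$. Then the Cayley digraph $\mathrm{Cay}(H,Y)$ is a directed strongly regular graph with parameter set $(2n^2,\,4n-2,\,2n+2,\,n+2,\,6)$.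
   Context: $S_2$ is the symmetric group on $\{1,2\}$, and $1^g,2^g$ denote the images of $1,2$ under $g\in S_2$. For a finite group $H$ and a subset $X\subseteq H$ not containing the identity, the Cayley digraph $\mathrm{Cay}(H,X)$ has vertex set $H$ and dart (arc) set $\{(x,y): x,y\in H,\ yx^{-1}\in X\}$. A directed strongly regular graph (DSRG) with parameter set $(N,k,t,\lambda,\mu)$ (in this order) is a loopless directed graph on $N$ vertices that is regular of valency $k$ (every vertex has in-degree and out-degree $k$), such that every vertex is incident with exactly $t$ undirected edges (an undirected edge is a pair of opposite arcs), and for any two distinct vertices $x,y$ the number of directed paths of length 2 from $x$ to $y$ is $\lambda$ if there is an arc from $x$ to $y$ and $\mu$ otherwise. Equivalently, its adjacency matrix $A$ (with zero diagonal) satisfies $AJ=JA=kJ$ and $A^2=tI+\lambda A+\mu(J-I-A)$, where $J$ is the all-one matrix and $I$ the identity matrix. *)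

(* Defs.v *)
From HB Require Import structures.
From mathcomp Require Import all_boot all_fingroup.

Set Implicit Arguments.
Unset Strict Implicit.
Unset Printing Implicit Defensive.

Local Open Scope group_scope.

(* The triple (g; k1, k2) of S_2 wr K.  The points 1, 2 permuted by S_2 are
   the elements 0, 1 of 'I_2, here named pt1, pt2. *)
Record wreathS2 (K : Type) : predArgType :=
  Wr { wr_perm : 'S_2; wr_fst : K; wr_snd : K }.

Definition pt1 : 'I_2 := ord0.
Definition pt2 : 'I_2 := ord_max.

Section WreathFinType.
Variable K : Type.

Definition wr_to_prod (x : wreathS2 K) : 'S_2 * K * K :=
  (wr_perm x, wr_fst x, wr_snd x).
Definition wr_of_prod (p : 'S_2 * K * K) : wreathS2 K :=
  Wr p.1.1 p.1.2 p.2.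

Lemma wr_to_prodK : cancel wr_to_prod wr_of_prod.
Proof. by case. Qed.
End WreathFinType.

HB.instance Definition _ (K : eqType) :=
  Equality.copy (wreathS2 K) (can_type (@wr_to_prodK K)).
HB.instance Definition _ (K : choiceType) :=
  Choice.copy (wreathS2 K) (can_type (@wr_to_prodK K)).
HB.instance Definition _ (K : countType) :=
  Countable.copy (wreathS2 K) (can_type (@wr_to_prodK K)).
HB.instance Definition _ (K : finType) :=
  Finite.copy (wreathS2 K) (can_type (@wr_to_prodK K)).

Section WreathGroup.
Variable K : finGroupType.
Implicit Types x y z : wreathS2 K.

Definition wr_coord x (i : 'I_2) : K := if i == pt1 then wr_fst x else wr_snd x.

(* i^g is the value g i, and products in 'S_2 act on the right:
   (g * h) i = h (g i). *)
Definition wr_mul x y : wreathS2 K :=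
  Wr (wr_perm x * wr_perm y)
     (wr_fst x * wr_coord y (wr_perm x pt1))
     (wr_snd x * wr_coord y (wr_perm x pt2)).

Definition wr_one : wreathS2 K := Wr 1 1 1.

Definition wr_inv x : wreathS2 K :=
  Wr (wr_perm x)^-1
     (wr_coord x ((wr_perm x)^-1 pt1))^-1
     (wr_coord x ((wr_perm x)^-1 pt2))^-1.

Lemma wr_coord_mul x y i :
  wr_coord (wr_mul x y) i = wr_coord x i * wr_coord y (wr_perm x i).
Proof.
rewrite {1 2}/wr_coord; case: eqP => [-> //|/eqP ni].
suff -> : i = pt2 by [].
by apply/val_inj; case: i ni => -[|[]].
Qed.

Lemma wr_mulA : associative wr_mul.
Proof.
move=> x y z; apply: (f_equal3 (@Wr K)); first exact: mulgA.
  by rewrite wr_coord_mul mulgA permM.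
by rewrite wr_coord_mul mulgA permM.
Qed.

Lemma wr_mul1 : left_id wr_one wr_mul.
Proof. by case=> g k1 k2; rewrite /wr_mul /= !perm1 !mul1g. Qed.

Lemma wr_mulV : left_inverse wr_one wr_inv wr_mul.
Proof. by case=> g k1 k2; rewrite /wr_mul /= !mulVg. Qed.

HB.instance Definition _ :=
  Finite_isGroup.Build (wreathS2 K) wr_mulA wr_mul1 wr_mulV.
End WreathGroup.

(* A loopless digraph on a finType is an irreflexive rel. *)
Definition cayley (H : finGroupType) (X : {set H}) : rel H :=
  fun x y => y * x^-1 \in X.

Definition dsrg (V : finType) (arc : rel V) (N k t lam mu : nat) : Prop :=
  [/\ #|V| = N,
      irreflexive arc,
      forall x, #|[set y | arc x y]| = k /\ #|[set y | arc y x]| = k,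
      forall x, #|[set y | arc x y && arc y x]| = t
    & forall x y, x != y ->
        #|[set z | arc x z && arc z y]| = if arc x y then lam else mu].

(* Main.v *)
(* In Cay(H, Y) the number of paths of length 2 from x to y is the number of
   s in Y with h s^-1 in Y, where h = y x^-1; the case h = 1 counts the
   undirected edges at x.  Letting s run separately over A, B, C and D turns
   this number into a sum of four counts over u in K, each governed by at most
   two equations determining u. *)

Require Import Defs.
From mathcomp Require Import all_boot all_fingroup.
From mathcomp Require Import zify.

Set Implicit Arguments.
Unset Strict Implicit.
Unset Printing Implicit Defensive.

Local Open Scope group_scope.

(** * Arithmetic in the wreath product of [S_2] and [K] *)

Local Notation e := (1 : 'S_2).
Local Notation pi := (tperm pt1 pt2).

Lemma tperm_S2_neq1 : (pi == e) = false.
Proof. by apply/eqP=> /permP/(_ pt1); rewrite tpermL perm1. Qed.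

Lemma S2_cases (g : 'S_2) : g = e \/ g = pi.
Proof.
have pt12 (i : 'I_2) : i = pt1 \/ i = pt2.
  by case: i => -[|[|//]] lti; [left | right]; apply: val_inj.
have: g pt1 != g pt2 by rewrite (inj_eq perm_inj).
(* Injectivity excludes two of the four pairs of images, leaving the identity and the
   transposition. *)
case: (pt12 (g pt1)) (pt12 (g pt2)) => g1 [] g2; rewrite g1 g2 // => _.
  by left; apply/permP=> i; rewrite perm1; case: (pt12 i) => ->.
by right; apply/permP=> i; case: (pt12 i) => ->; rewrite ?tpermL ?tpermR.
Qed.

Section WreathS2.
Variable K : finGroupType.
Implicit Types (a b c d u : K) (g : 'S_2).

Lemma wr_eqE g g' a b a' b' :
  (Wr g a b == Wr g' a' b') = [&& g == g', a == a' & b == b'].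
Proof. by apply/eqP/and3P=> [[-> -> ->]|[/eqP-> /eqP-> /eqP->]]. Qed.

Lemma wr_mulee a b c d : Wr e a b * Wr e c d = Wr e (a * c) (b * d).
Proof. by rewrite /mulg /= /wr_mul /= !perm1 mulg1. Qed.

Lemma wr_mulep a b c d : Wr e a b * Wr pi c d = Wr pi (a * c) (b * d).
Proof. by rewrite /mulg /= /wr_mul /= !perm1 mul1g. Qed.

Lemma wr_mulpe a b c d : Wr pi a b * Wr e c d = Wr pi (a * d) (b * c).
Proof. by rewrite /mulg /= /wr_mul /= tpermL tpermR mulg1. Qed.

Lemma wr_mulpp a b c d : Wr pi a b * Wr pi c d = Wr e (a * d) (b * c).
Proof. by rewrite /mulg /= /wr_mul /= tpermL tpermR tperm2. Qed.

Definition wr_mulE := (wr_mulee, wr_mulep, wr_mulpe, wr_mulpp).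

(** The four quotient formulas are checked by multiplying back, which avoids unfolding [wr_inv]. *)
Lemma wr_divee a b c d : Wr e a b * (Wr e c d)^-1 = Wr e (a * c^-1) (b * d^-1).
Proof. by apply: (canLR (mulgK _)); rewrite wr_mulE !mulgVK. Qed.

Lemma wr_divep a b c d :
  Wr e a b * (Wr pi c d)^-1 = Wr pi (a * d^-1) (b * c^-1).
Proof. by apply: (canLR (mulgK _)); rewrite wr_mulE !mulgVK. Qed.

Lemma wr_divpe a b c d :
  Wr pi a b * (Wr e c d)^-1 = Wr pi (a * d^-1) (b * c^-1).
Proof. by apply: (canLR (mulgK _)); rewrite wr_mulE !mulgVK. Qed.

Lemma wr_divpp a b c d :
  Wr pi a b * (Wr pi c d)^-1 = Wr e (a * c^-1) (b * d^-1).
Proof. by apply: (canLR (mulgK _)); rewrite wr_mulE !mulgVK. Qed.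

Definition wr_divE := (wr_divee, wr_divep, wr_divpe, wr_divpp).

Lemma card_wreathS2 : #|{: wreathS2 K}| = (2 * #|K| ^ 2)%N.
Proof.
have -> : #|{: wreathS2 K}| = #|{: 'S_2 * K * K}|.
  apply: (bij_eq_card (f := @wr_to_prod K)).
  by exists (@wr_of_prod K); [exact: wr_to_prodK | case=> -[]].
by rewrite !card_prod card_Sn -mulnA.
Qed.

(** * Counting elements of [K] under equations and inequations *)

Lemma card_imset_filter (T : finType) (f : K -> T) (S : {pred K}) (P : pred T) :
  injective f -> #|(f @: S) :&: [set s | P s]| = #|[set u in S | P (f u)]|.
Proof.
move=> f_inj; rewrite -(card_imset _ f_inj); apply: eq_card => s.
rewrite in_setI inE; apply/andP/imsetP=> [[/imsetP[u uS ->] Pu]|[u + ->]].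
  by exists u; rewrite // inE uS.
by rewrite inE => /andP[uS Pu]; rewrite imset_f.
Qed.

Lemma divg_eq a u c : (a * u^-1 == c) = (u == c^-1 * a).
Proof.
by apply/eqP/eqP=> [<-|->]; rewrite invMg invgK ?mulgVK // mulVKg.
Qed.

Lemma card_divg_eq2 a c d :
  c != d -> #|[set u | (a * u^-1 == c) || (a * u^-1 == d)]| = 2.
Proof.
move=> cd; rewrite -(_ : #|[set c^-1 * a; d^-1 * a]| = 2).
  by apply: eq_card => u; rewrite !inE !divg_eq.
by rewrite cards2 (inj_eq (mulIg a)) (inj_eq invg_inj) cd.
Qed.

Lemma card_pred_eq1 (T : finType) (P : pred T) (t : T) :
  #|[set u | P u && (u == t)]| = P t.
Proof.
have [Pt|nPt] := boolP (P t).
  rewrite -[RHS]/1%N -(cards1 t); apply: eq_card => u; rewrite !inE.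
  by case: eqP => [->|]; rewrite ?Pt ?andbF.
apply/eqP; rewrite cards_eq0; apply/eqP/setP=> u; rewrite !inE.
by case: eqP => [->|]; rewrite ?(negPf nPt) ?andbF.
Qed.

Lemma card_neq1 : #|[set u : K | u != 1]| = #|K|.-1.
Proof. by rewrite -(cardsC1 (1 : K)); apply: eq_card => u; rewrite !inE. Qed.

Lemma card_neq1_neq b :
  #|[set u | (u != 1) && (u != b)]| = (#|K|.-1 - (b != 1%g))%N.
Proof.
rewrite -card_neq1 [in RHS](cardsD1 b) inE addKn.
by apply: eq_card => u; rewrite !inE andbC.
Qed.

(** Serves [s = (e;u,u)] in A and [h = (e;a,b)]. If [a = b], only [u = 1] and [u = b] are excluded.
    Otherwise the disjunction forces [u = a], and then [b * u^-1 != 1] is automatic. *)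
Lemma card_wr_div_diag a b :
  #|[set u | (u != 1) && ((b * u^-1 != 1)
      && ((a * u^-1 == b * u^-1) || (a * u^-1 == 1)))]|
  = if a == b then (#|K|.-1 - (b != 1%g))%N else (a != 1).
Proof.
have [->|ab] := eqVneq a b.
  rewrite -card_neq1_neq; apply: eq_card => u.
  by rewrite !inE eqxx andbT divg_eq invg1 mul1g.
rewrite -(card_pred_eq1 (fun u => u != 1)); apply: eq_card => u.
rewrite !inE (inj_eq (mulIg _)) (negPf ab) !divg_eq invg1 !mul1g.
by have [->|] := eqVneq u a; rewrite ?ab ?andbF.
Qed.

(** Serves [s = (e;1,u)] in B and [h = (e;a,b)]. If [a != 1], then [u] must be [a^-1 * b], so that
    [b * u^-1 = a] is automatically nontrivial; what remains is [u != 1], that is [a != b]. *)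
Lemma card_wr_div_snd a b :
  #|[set u | (u != 1) && ((b * u^-1 != 1)
      && ((a == b * u^-1) || (a == 1)))]|
  = if a == 1 then (#|K|.-1 - (b != 1%g))%N else (a != b).
Proof.
have [->|a1] := eqVneq a 1.
  rewrite -card_neq1_neq; apply: eq_card => u.
  by rewrite !inE orbT andbT divg_eq invg1 mul1g.
have -> : (a != b) = (a^-1 * b != 1) by rewrite -eq_mulVg1.
rewrite -(card_pred_eq1 (fun u => u != 1)); apply: eq_card => u.
rewrite !inE orbF [a == _ * _]eq_sym !divg_eq invg1 mul1g.
have [->|] := eqVneq u (a^-1 * b); rewrite ?andbF // !andbT.
by rewrite [_ == b]eq_mulgV1 mulgK invg_eq1 a1 andbT.
Qed.

(** Serves [s] in A and [h = (pi;a,b)], with [c = 1] and [d = w]. Of the two solutions [u], one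
    equals 1 exactly when [b] is [c] or [d]. *)
Lemma card_neq1_divg_eq2 b c d : c != d ->
  #|[set u | (u != 1) && ((b * u^-1 == c) || (b * u^-1 == d))]|
  = (2 - ((b == c) || (b == d)))%N.
Proof.
move=> cd; rewrite -(card_divg_eq2 b cd) [in RHS](cardsD1 1).
rewrite !inE invg1 mulg1 addKn.
by apply: eq_card => u; rewrite !inE.
Qed.

(** Serves [s = (e;1,u)] in B and [h = (pi;a,b)]: the second coordinate of [h * s^-1] is [b], so
    membership does not depend on [u]. *)
Lemma card_neq1_cond (P : bool) :
  #|[set u : K | (u != 1) && P]| = (if P then #|K|.-1 else 0)%N.
Proof.
case: P; first by rewrite -card_neq1; apply: eq_card => u; rewrite !inE andbT.
by apply/eqP; rewrite cards_eq0; apply/eqP/setP=> u; rewrite !inE andbF.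
Qed.

(** Serves [h = (pi;a,b)] with [s] in C or D; [c] is the second coordinate of [h * s^-1], namely [b]
    for C and [b * w^-1] for D. *)
Lemma card_divg_cond a c :
  #|[set u | (c != 1) && ((a * u^-1 == c) || (a * u^-1 == 1))]|
  = (if c == 1%g then 0 else 2)%N.
Proof.
have [->|c1] := eqVneq c 1; last by rewrite card_divg_eq2.
by apply/eqP; rewrite cards_eq0; apply/eqP/setP=> u; rewrite !inE.
Qed.

(** * The connection set and its quotient counts *)

Section ConnectionSet.
Variable w : K.
Hypothesis w_neq1 : w != 1.

Local Notation A := [set Wr e u u | u : K & u != 1].
Local Notation B := [set Wr e 1 u | u : K & u != 1].
Local Notation C := [set Wr pi u 1 | u : K].
Local Notation D := [set Wr pi u w | u : K].

Definition wr_conn : {set wreathS2 K} := A :|: B :|: C :|: D.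

Lemma wr_conn_e a b :
  (Wr e a b \in wr_conn) = (b != 1) && ((a == b) || (a == 1)).
Proof.
rewrite !inE; apply/idP/idP=> [|/andP[b1 /orP[/eqP->|/eqP->]]]; last first.
- by rewrite (imset_f (fun u => Wr e 1 u)) ?orbT // inE.
- by rewrite (imset_f (fun u => Wr e u u)) // inE.
case/orP=> [/orP[/orP[]|]|] /imsetP[u + /eqP].
- by rewrite inE wr_eqE => u1 /and3P[_ /eqP-> /eqP->]; rewrite u1 eqxx.
- by rewrite inE wr_eqE => u1 /and3P[_ /eqP-> /eqP->]; rewrite u1 eqxx orbT.
- by rewrite wr_eqE eq_sym tperm_S2_neq1.
- by rewrite wr_eqE eq_sym tperm_S2_neq1.
Qed.

Lemma wr_conn_pi a b : (Wr pi a b \in wr_conn) = (b == 1) || (b == w).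
Proof.
rewrite !inE; apply/idP/idP=> [|/orP[/eqP->|/eqP->]]; last first.
- by rewrite (imset_f (fun u => Wr pi u w)) ?orbT // inE.
- by rewrite (imset_f (fun u => Wr pi u 1)) ?orbT // inE.
case/orP=> [/orP[/orP[]|]|] /imsetP[u _ /eqP]; rewrite wr_eqE.
- by rewrite tperm_S2_neq1.
- by rewrite tperm_S2_neq1.
- by case/and3P=> _ _ ->.
- by case/and3P=> _ _ ->; rewrite orbT.
Qed.

(** The [S_2] component separates A and B from C and D, the first coordinate separates A from B, and
    [w != 1] separates C from D. Each piece is parametrized injectively by [u]. *)
Lemma card_wr_conn (P : pred (wreathS2 K)) :
  #|[set s in wr_conn | P s]| =
    (#|[set u | (u != 1%g) && P (Wr e u u)]|
     + #|[set u | (u != 1%g) && P (Wr e 1%g u)]|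
     + #|[set u | P (Wr pi u 1%g)]| + #|[set u | P (Wr pi u w)]|)%N.
Proof.
have disj (S T : {set wreathS2 K}) : [disjoint S & T] ->
    #|(S :|: T) :&: [set s | P s]|
    = (#|S :&: [set s | P s]| + #|T :&: [set s | P s]|)%N.
  move=> dST; rewrite setIUl cardsU; set X := _ :&: (_ :&: _).
  suff -> : X = set0 by rewrite cards0 subn0.
  by apply/eqP; rewrite -subset0 -(disjoint_setI0 dST) setISS // subsetIl.
have -> : [set s in wr_conn | P s] = wr_conn :&: [set s | P s].
  by apply/setP=> s; rewrite !inE.
have pe := tperm_S2_neq1.
rewrite !disj; first last.
- rewrite disjoints_subset; apply/subsetP=> s.
  rewrite !inE => /orP[/orP[]|] /imsetP[u _ ->]; apply/imsetP=> -[v _ /eqP].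
  + by rewrite wr_eqE eq_sym pe.
  + by rewrite wr_eqE eq_sym pe.
  by rewrite wr_eqE (eq_sym 1) (negPf w_neq1) !andbF.
- rewrite disjoints_subset; apply/subsetP=> s.
  rewrite !inE => /orP[] /imsetP[u _ ->]; apply/imsetP=> -[v _ /eqP].
    by rewrite wr_eqE eq_sym pe.
  by rewrite wr_eqE eq_sym pe.
- rewrite disjoints_subset; apply/subsetP=> s /imsetP[u + ->].
  rewrite !inE => u1; apply/imsetP=> -[v _ /eqP].
  by rewrite wr_eqE (negPf u1) andbF.
rewrite !card_imset_filter; try by move=> u v [].
by congr (_ + _ + _ + _)%N; apply: eq_card => u; rewrite !inE.
Qed.

Lemma card_wr_conn_div (h : wreathS2 K) :
  #|[set s in wr_conn | h * s^-1 \in wr_conn]| =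
    if h == 1 then (2 * #|K| + 2)%N
    else if h \in wr_conn then (#|K| + 2)%N else 6.
Proof.
(* Two elements are needed for the truncated [#|K|.-1 - 1] to be a true difference. *)
have K_gt1 : (1 < #|K|)%N.
  by rewrite (cardD1 1) (cardD1 w) !inE w_neq1.
rewrite card_wr_conn.
case: h => g a b; have [->|->] := S2_cases g.
  under eq_finset => u do rewrite wr_divE wr_conn_e.
  rewrite card_wr_div_diag.
  under eq_finset => u do rewrite wr_divE wr_conn_e invg1 mulg1.
  rewrite card_wr_div_snd.
  under eq_finset => u do rewrite wr_divE wr_conn_pi.
  (* The pattern reaches the D summand. The C and D counts then coincide, and one rewrite evaluates
     both to 2. *)
  under [in X in (_ + X)%N]eq_finset => u do rewrite wr_divE wr_conn_pi.
  rewrite card_divg_eq2 1?eq_sym // (wr_eqE e e) eqxx /= wr_conn_e //=.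
  rewrite (eq_sym b a); move: #|K| K_gt1 => n n_gt1.
  (* C and D give 4 in all. A and B together give [2n - 2] for [h = 1], [n - 2] for [h] in A or B,
     and [1 + 1] otherwise. *)
  have [->|a1] := eqVneq a 1.
    by have [_|_] := eqVneq b 1; rewrite ?eqxx /=; lia.
  by have [<-|_] := eqVneq a b; rewrite ?a1 /= ?andbF; lia.
under eq_finset => u do rewrite wr_divE wr_conn_pi.
rewrite card_neq1_divg_eq2 1?eq_sym //.
under eq_finset => u do rewrite wr_divE wr_conn_pi invg1 mulg1.
rewrite card_neq1_cond.
under eq_finset => u do rewrite wr_divE wr_conn_e invg1 mulg1.
rewrite card_divg_cond.
under eq_finset => u do rewrite wr_divE wr_conn_e.
rewrite card_divg_cond -eq_mulgV1 (wr_eqE pi e) tperm_S2_neq1 /= wr_conn_pi.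
move: #|K| K_gt1 => n n_gt1.
(* The counts over A, B, C, D are 1, [n - 1], 0, 2 for [b = 1]; 1, [n - 1], 2, 0 for [b = w]; and 2,
   0, 2, 2 otherwise. *)
have [->|b1] := eqVneq b 1; first by rewrite eq_sym (negPf w_neq1) /=; lia.
by have [_|_] := eqVneq b w; rewrite /=; lia.
Qed.

Lemma card_wr_conn_set : #|wr_conn| = (4 * #|K| - 2)%N.
Proof.
have K_gt0 : (0 < #|K|)%N by apply/card_gt0P; exists w.
(* The trivial predicate turns the fourfold count into the size of the set,
   [(n - 1) + (n - 1) + n + n]. *)
have /eq_card -> : wr_conn =i [set s in wr_conn | predT s].
  by move=> s; rewrite [in RHS]inE andbT.
rewrite card_wr_conn /= cardsT.
under eq_finset => u do rewrite andbT.
by rewrite card_neq1; move: #|K| K_gt0 => n n_gt0; lia.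
Qed.

Lemma wr_conn1 : 1 \notin wr_conn.
Proof. by rewrite wr_conn_e eqxx. Qed.

End ConnectionSet.
End WreathS2.

(** * Degrees and 2-paths in an arbitrary Cayley digraph *)

Section CayleyCount.
Variables (H : finGroupType) (X : {set H}).

Lemma card_cayley_out x : #|[set y | cayley X x y]| = #|X|.
Proof.
by rewrite -(card_preimset X (mulIg x^-1)); apply: eq_card => y; rewrite !inE.
Qed.

Lemma card_cayley_in x : #|[set y | cayley X y x]| = #|X|.
Proof.
have f_inj : injective (fun y => x * y^-1) by move=> y z /mulgI/invg_inj.
by rewrite -(card_preimset X f_inj); apply: eq_card => y; rewrite !inE.
Qed.

(** Substitute [s = z * x^-1], so that [y * z^-1 = y * x^-1 * s^-1]. Taking [y = x] is allowed and
    counts undirected edges. *)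
Lemma card_cayley_path2 x y :
  #|[set z | cayley X x z && cayley X z y]|
  = #|[set s in X | y * x^-1 * s^-1 \in X]|.
Proof.
rewrite -[RHS](card_preimset _ (mulIg x^-1)); apply: eq_card => z.
by rewrite !inE /cayley invMg invgK mulgA mulgVK.
Qed.

End CayleyCount.

Theorem theorem3p3 (n : nat) (K : finGroupType) (w : K)
    (n_gt2 : (2 < n)%N) (cardK : #|K| = n) (w_neq1 : w != 1) :
  let e : 'S_2 := 1 in
  let pi : 'S_2 := tperm pt1 pt2 in
  let A : {set wreathS2 K} := [set Wr e u u | u : K & u != 1] in
  let B : {set wreathS2 K} := [set Wr e 1 u | u : K & u != 1] in
  let C : {set wreathS2 K} := [set Wr pi u 1 | u : K] in
  let D : {set wreathS2 K} := [set Wr pi u w | u : K] in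
  let Y := A :|: B :|: C :|: D in
  dsrg (cayley Y) (2 * n ^ 2)%N (4 * n - 2)%N (2 * n + 2)%N (n + 2)%N 6.
Proof.
move=> e pi A B C D Y; rewrite -[Y]/(wr_conn w) -cardK; split.
- exact: card_wreathS2.
- by move=> x; rewrite /cayley mulgV (negPf (wr_conn1 w)).
- by move=> x; rewrite card_cayley_out card_cayley_in card_wr_conn_set.
- by move=> x; rewrite card_cayley_path2 mulgV card_wr_conn_div // eqxx.
move=> x y xy; rewrite card_cayley_path2 card_wr_conn_div //.
(* Distinctness of [x] and [y] rules out [h = 1]; the remaining test [h \in Y] is by definition the
   arc from [x] to [y]. *)
by rewrite -eq_mulgV1 eq_sym (negPf xy).
Qed.
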